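(* Let $f$ be a non-square positive integer with $\sqrt{f}=[\,a_0;\overline{a_1,\dots,a_n,2a_0}\,]$, and let $(c,h)$ be the smallest pair of positive integers with $c^2-fh^2=1$. Let $$f(t)=(c-1)^2h^6t^4+4(c-1)^2h^4t^3+6(c-1)^2h^2t^2+2(c-1)(2c-1)t+f.$$ Let $t\ge 0$ be an integer. (i) If $n$ is odd and $\sqrt{f}=[\,a_0;\overline{a_1,\dots,a_{m-1},a_m,a_{m-1},\dots,a_1,2a_0}\,]$ with $a_m=a_0$ or $a_m=a_0-1$ and $m$ odd, then $$\sqrt{f(t)}=[\,(c-1)(h^3t^2+2ht)+a_0;\overline{a_1,\dots,a_{m-1},(c-1)ht+a_m,a_{m-1},\dots,a_1,2(c-1)(h^3t^2+2ht)+2a_0}\,].$$ (ii) If $n$ is even, then $$\sqrt{f(t)}=[\,(c-1)(h^3t^2+2ht)+a_0;\overline{a_1,\dots,a_n,2(c-1)ht+2a_0,a_1,\dots,a_n,2(c-1)(h^3t^2+2ht)+2a_0}\,].$$ (iii) Under the hypotheses of either (i) or (ii), $X=(c-1)h^6t^3+3(c-1)h^4t^2+3(c-1)h^2t+c$, $Y=h+h^3t$ is the fundamental solution (smallest solution in positive integers) of $X^2-f(t)Y^2=1$.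
   Context: $[\,b_0;\overline{b_1,\dots,b_k}\,]$ denotes the simple periodic continued fraction with the overlined block repeating; the period of $\sqrt f=[\,a_0;\overline{a_1,\dots,a_n,2a_0}\,]$ has length $n+1$. The fundamental solution of $X^2-DY^2=1$ is its smallest solution in positive integers.
   Formalization: Part (i) is stated without the cases f = 8 and f = 12 with t > 0, where the printed expansion is false (f = 8, t = 1: √72 = [8; 2,16] with the bar over 2,16, not 3,16); parts (ii) and (iii) are unrestricted. *)

(* Defs.v *)
From Stdlib Require Import Reals ZArith Arith List.
From Coquelicot Require Import Coquelicot.

(* The finite continued fraction b 0 + 1/(b 1 + ... + 1/b k). *)
Fixpoint cf_fin (b : nat -> Z) (k : nat) : R :=
  match k with
  | O => IZR (b O)
  | S k' => (IZR (b O) + / cf_fin (fun i => b (S i)) k')%R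
  end.

(* "Simple" means that all partial quotients after the integer b 0 are positive
   integers. *)
Definition is_simple_cf (x : R) (b : nat -> Z) : Prop :=
  (forall i : nat, (0 < b (S i))%Z) /\ is_lim_seq (cf_fin b) (Finite x).

(* The sequence b0, l, l, l, ... *)
Definition periodic_quotients (b0 : Z) (l : list Z) (i : nat) : Z :=
  match i with
  | O => b0
  | S j => nth (j mod length l)%nat l 0%Z
  end.

(* x = [ b0; overline l ].  The block l need not be of minimal length. *)
Definition is_periodic_cf (x : R) (b0 : Z) (l : list Z) : Prop :=
  l <> nil /\ is_simple_cf x (periodic_quotients b0 l).

(* x = [ b0; overline l ] where length l is the least period of the sequence of
   partial quotients after b0. *)
Definition is_periodic_cf_min (x : R) (b0 : Z) (l : list Z) : Prop :=
  is_periodic_cf x b0 l /\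
  forall p : nat, (0 < p)%nat ->
    (forall i : nat, periodic_quotients b0 l (S (i + p)) =
                     periodic_quotients b0 l (S i)) ->
    (length l <= p)%nat.

(* For D > 0 the positive solutions are totally ordered, X and Y growing
   together, so the smallest one is smallest in both coordinates. *)
Definition is_fundamental_solution (D X Y : Z) : Prop :=
  (0 < X /\ 0 < Y /\ X ^ 2 - D * Y ^ 2 = 1 /\
   forall x y : Z, 0 < x -> 0 < y -> x ^ 2 - D * y ^ 2 = 1 -> X <= x /\ Y <= y)%Z.

(* The list a_1, ..., a_k. *)
Definition block (a : nat -> Z) (k : nat) : list Z := map a (seq 1 k).

Definition quartic (f c h t : Z) : Z :=
  ((c - 1) ^ 2 * h ^ 6 * t ^ 4 + 4 * (c - 1) ^ 2 * h ^ 4 * t ^ 3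
   + 6 * (c - 1) ^ 2 * h ^ 2 * t ^ 2 + 2 * (c - 1) * (2 * c - 1) * t + f)%Z.

(* n and m are odd, a_1, ..., a_n is the palindrome
   a_1, ..., a_(m-1), a_m, a_(m-1), ..., a_1, and a_m is a_0 or a_0 - 1. *)
Definition odd_central (a : nat -> Z) (n m : nat) : Prop :=
  Nat.Odd n /\ Nat.Odd m /\
  block a n = block a (m - 1) ++ a m :: rev (block a (m - 1)) /\
  (a m = a O \/ a m = (a O - 1)%Z).

(* Main.v *)
(* A list l has continuant matrix [cf_mat l] = product of [[b, 1], [1, 0]] over b in l,
   and sqrt D = [A; l, 2A periodic] holds iff this matrix is symmetric, [[p, q], [q, s]],
   with 2 A q + s = p (D - A^2). So (i) and (ii) become polynomial identities, once
   c and h are expressed through the continuants of the block of sqrt f.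

   A Pell solution (c, h) gives a unimodular nonnegative matrix fixing sqrt f; Euclid's
   algorithm factors it into matrices [[b, 1], [1, 0]], and uniqueness of continued
   fractions identifies the b's with quotients of sqrt f over an even number of steps that
   is a period. Minimality of the block then gives (c, h) = (a0 p + q, p) for n odd, and
   (2 X^2 + 1, 2 X p) with X = a0 p + q for n even.

   In case (i) let [[u, v], [w, z]] be the matrix of a_1, ..., a_(m-1), and X = a0 u + w.
   The condition on a_m forces f u^2 - X^2 = 2 unless f = 8 or f = 12, and then
   c = X^2 + 1, h = u X.

   (iii) needs no continued fractions: a positive solution of X^2 - D Y^2 = 1 with
   Y^2 < 2 X + 2 is fundamental, which holds for all t >= 1. *)
Require Import Defs.
From Stdlib Require Import Lia Lra Reals ZArith Arith List.
From Coquelicot Require Import Coquelicot.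
Import ListNotations.
Local Open Scope Z_scope.


(** * Pell equations: recognizing a fundamental solution by its size *)

(** If [0 < y < Y], eliminating [D] gives [(x Y - X y) (x Y + X y) = Y^2 - y^2 > 0]. The first
    factor is then at least 1, so [Y^2 - y^2 >= 2 X y + 1] and hence [Y^2 >= 2 X + 2]. *)
Lemma pell_fundamental_of_large (D X Y : Z) :
  0 < X -> 0 < Y -> X ^ 2 - D * Y ^ 2 = 1 -> Y ^ 2 < 2 * X + 2 ->
  is_fundamental_solution D X Y.
Proof.
  intros HX HY HD HL. split; [exact HX | split; [exact HY | split; [exact HD |]]].
  intros x y Hx Hy E.
  assert (HDp : 0 <= D) by nia.
  assert (Hy' : Y <= y).
  { destruct (Z_lt_le_dec y Y) as [L|]; [exfalso | assumption].
    assert (K : (x * Y - X * y) * (x * Y + X * y) = Y ^ 2 - y ^ 2).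
    { replace ((x * Y - X * y) * (x * Y + X * y))
        with ((x ^ 2 - D * y ^ 2) * Y ^ 2 - (X ^ 2 - D * Y ^ 2) * y ^ 2) by ring.
      rewrite E, HD. ring. }
    assert (0 < x * Y + X * y) by nia.
    assert (1 <= x * Y - X * y) by nia.
    assert (2 * (X * y) + 1 <= Y ^ 2 - y ^ 2) by nia.
    assert (X <= X * y) by nia.
    assert (1 <= y ^ 2) by nia.
    lia. }
  split; [| exact Hy'].
  assert (Y ^ 2 <= y ^ 2) by nia.
  assert (X ^ 2 <= x ^ 2) by nia.
  nia.
Qed.

Lemma quartic_fundamental (f c h t : Z) :
  0 < f -> is_fundamental_solution f c h -> 0 <= t ->
  is_fundamental_solution (quartic f c h t)
    ((c - 1) * h ^ 6 * t ^ 3 + 3 * (c - 1) * h ^ 4 * t ^ 2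
     + 3 * (c - 1) * h ^ 2 * t + c)
    (h + h ^ 3 * t).
Proof.
  intros Hf F Ht.
  (* The size criterion can fail at [t = 0], as for [f = 13] with [(c, h) = (649, 180)]; there the
     given solution itself is the answer. *)
  destruct (Z.eq_dec t 0) as [-> | Ht0].
  { unfold quartic.
    replace ((c - 1) * h ^ 6 * 0 ^ 3 + 3 * (c - 1) * h ^ 4 * 0 ^ 2
             + 3 * (c - 1) * h ^ 2 * 0 + c) with c by ring.
    replace (h + h ^ 3 * 0) with h by ring.
    match goal with |- is_fundamental_solution ?D _ _ => replace D with f by ring end.
    exact F. }
  destruct F as (Hc & Hh & E & _).
  assert (Hc2 : 1 <= c - 1) by nia.
  assert (H2 : 1 <= h ^ 2) by nia.
  assert (H4 : h ^ 4 = h ^ 2 * h ^ 2) by ring.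
  assert (H6 : h ^ 6 = h ^ 2 * h ^ 2 * h ^ 2) by ring.
  assert (T3 : t ^ 3 = t * t ^ 2) by ring.
  assert (T2 : t <= t ^ 2) by nia.
  assert (A1 : t ^ 2 <= t ^ 3) by nia.
  assert (0 < h ^ 4) by nia.
  assert (0 < h ^ 6) by nia.
  (* [Y^2 = h^6 t^2 + 2 h^4 t + h^2] is compared with [X] term by term. *)
  assert (B1 : h ^ 6 * t ^ 2 <= (c - 1) * h ^ 6 * t ^ 3).
  { assert (h ^ 6 * t ^ 2 <= h ^ 6 * t ^ 3) by nia. nia. }
  assert (B2 : h ^ 4 * t <= (c - 1) * h ^ 4 * t ^ 2).
  { assert (h ^ 4 * t <= h ^ 4 * t ^ 2) by nia. nia. }
  assert (B3 : h ^ 2 <= (c - 1) * h ^ 2 * t).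
  { assert (h ^ 2 <= h ^ 2 * t) by nia. nia. }
  assert (0 <= h ^ 6 * t ^ 2) by nia.
  assert (0 <= h ^ 4 * t) by nia.
  apply pell_fundamental_of_large.
  - lia.
  - assert (0 <= h ^ 3 * t) by nia. lia.
  - apply Z.sub_move_0_r.
    transitivity ((1 + h ^ 2 * t) ^ 2 * (c ^ 2 - f * h ^ 2 - 1)).
    + unfold quartic. ring.
    + rewrite E. ring.
  - replace ((h + h ^ 3 * t) ^ 2) with (h ^ 2 + 2 * (h ^ 4 * t) + h ^ 6 * t ^ 2) by ring.
    lia.
Qed.


(** * Continuant matrices and Euclid's algorithm *)

Record mat2 := Mat2 { e11 : Z; e12 : Z; e21 : Z; e22 : Z }.

Definition mul2 (A B : mat2) : mat2 :=
  Mat2 (e11 A * e11 B + e12 A * e21 B) (e11 A * e12 B + e12 A * e22 B)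
       (e21 A * e11 B + e22 A * e21 B) (e21 A * e12 B + e22 A * e22 B).

Definition det2 (A : mat2) : Z := e11 A * e22 A - e12 A * e21 A.

Definition tr2 (A : mat2) : mat2 := Mat2 (e11 A) (e21 A) (e12 A) (e22 A).

Fixpoint cf_mat (l : list Z) : mat2 :=
  match l with
  | [] => Mat2 1 0 0 1
  | b :: l' => mul2 (Mat2 b 1 1 0) (cf_mat l')
  end.

Lemma mul2A (A B C : mat2) : mul2 A (mul2 B C) = mul2 (mul2 A B) C.
Proof. unfold mul2; cbn [e11 e12 e21 e22]; f_equal; ring. Qed.

Lemma cf_mat_app (l1 l2 : list Z) :
  cf_mat (l1 ++ l2) = mul2 (cf_mat l1) (cf_mat l2).
Proof.
  induction l1 as [|b l1 IH]; simpl.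
  - destruct (cf_mat l2); unfold mul2; cbn [e11 e12 e21 e22]; f_equal; ring.
  - rewrite IH. apply mul2A.
Qed.

Lemma cf_mat_rev (l : list Z) : cf_mat (rev l) = tr2 (cf_mat l).
Proof.
  induction l as [|b l IH]; [reflexivity |].
  cbn [rev]. rewrite cf_mat_app, IH. unfold tr2; cbn [cf_mat]; unfold mul2; cbn [e11 e12 e21 e22]. f_equal; ring.
Qed.

Lemma det2_cf_mat (l : list Z) :
  det2 (cf_mat l) = if Nat.even (length l) then 1 else -1.
Proof.
  induction l as [|b l IH]; [reflexivity |].
  replace (det2 (cf_mat (b :: l))) with (- det2 (cf_mat l))
    by (unfold det2; cbn [cf_mat mul2 e11 e12 e21 e22]; ring).
  rewrite IH. cbn [length]. rewrite Nat.even_succ. unfold Nat.odd.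
  now destruct (Nat.even (length l)).
Qed.

(** The bound on the bottom-row sum keeps the denominator of the associated Moebius map positive at
    positive reals. *)
Lemma cf_mat_nonneg (l : list Z) : List.Forall (Z.lt 0) l ->
  1 <= e11 (cf_mat l) /\ 0 <= e12 (cf_mat l) /\ 0 <= e21 (cf_mat l) /\
  0 <= e22 (cf_mat l) /\ 1 <= e21 (cf_mat l) + e22 (cf_mat l) /\
  1 <= e12 (cf_mat l) + e22 (cf_mat l).
Proof.
  induction 1 as [|b l Hb Hl IH]; [simpl; lia |].
  cbn [cf_mat mul2 e11 e12 e21 e22]. repeat split; nia.
Qed.

(** The right column holds the continuants of the list without its last entry, which are no larger.
    The identity matrix of the empty list is an exception. *)
Lemma cf_mat_monotone (b : Z) (l : list Z) : List.Forall (Z.lt 0) (b :: l) ->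
  e22 (cf_mat (b :: l)) <= e21 (cf_mat (b :: l)) /\
  e12 (cf_mat (b :: l)) <= e11 (cf_mat (b :: l)).
Proof.
  revert b; induction l as [|b' l IH]; intros b H; inversion H as [|? ? Hb Hl]; subst.
  - simpl. lia.
  - destruct (IH b' Hl) as [I1 I2].
    change (cf_mat (b :: b' :: l)) with (mul2 (Mat2 b 1 1 0) (cf_mat (b' :: l))).
    cbn [mul2 e11 e12 e21 e22]. nia.
Qed.

Lemma cf_mat_e11_prefix (l1 l2 : list Z) :
  List.Forall (Z.lt 0) (l1 ++ l2) ->
  e11 (cf_mat l1) <= e11 (cf_mat (l1 ++ l2)).
Proof.
  intros H. apply Forall_app in H. destruct H as [H1 H2].
  apply cf_mat_nonneg in H1. apply cf_mat_nonneg in H2.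
  rewrite cf_mat_app. cbn [mul2 e11]. nia.
Qed.

(* Euclid's algorithm on the bottom row, run from the last factor; the last step
   has two candidate quotients, and the sign of the determinant selects one. *)
Lemma cf_mat_decompose (T : mat2) :
  0 < e22 T < e21 T -> (det2 T = 1 \/ det2 T = -1) ->
  exists b l, List.Forall (Z.lt 0) l /\ T = cf_mat (b :: l).
Proof.
  remember (Z.to_nat (e22 T)) as k eqn:Hk.
  revert T Hk; induction k as [k IH] using lt_wf_ind; intros [A B C D] Hk HC Hdet.
  unfold det2 in Hdet; cbn [e11 e12 e21 e22] in *.
  pose proof (Z.div_mod C D ltac:(lia)) as E.
  pose proof (Z.mod_pos_bound C D ltac:(lia)) as R.
  pose proof (Z.div_str_pos C D ltac:(lia)) as He.
  set (e := C / D) in *. set (r := C mod D) in *. clearbody e r.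
  destruct (Z.eq_dec r 0) as [R0 | R0].
  - subst r. rewrite Z.add_0_r in E. subst C.
    assert (D = 1).
    { destruct Hdet as [Hdet | Hdet].
      - destruct (Z.mul_eq_1 D (A - B * e)); lia.
      - destruct (Z.mul_eq_1 D (B * e - A)); lia. }
    subst D. rewrite Z.mul_1_l in *.
    destruct Hdet as [Hdet | Hdet].
    + exists B, [e]. split; [repeat constructor; lia |].
      cbn [cf_mat]; unfold mul2; cbn [e11 e12 e21 e22]. f_equal; nia.
    + exists (B - 1), [1; e - 1]. split; [repeat constructor; lia |].
      cbn [cf_mat]; unfold mul2; cbn [e11 e12 e21 e22]. f_equal; nia.
  (* Splitting off [[[e, 1], [1, 0]]] on the right leaves the bottom row [(D, r)] and negates the
     determinant. *)
  - destruct (IH (Z.to_nat r) ltac:(lia) (Mat2 B (A - e * B) D r)) as (b & l & Hl & ET).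
    + reflexivity.
    + simpl; lia.
    + unfold det2; simpl.
      replace (B * r - (A - e * B) * D) with (- (A * D - B * C))
        by (rewrite E; ring).
      lia.
    + exists b, (l ++ [e]). split; [apply Forall_app; split; [exact Hl | repeat constructor; lia] |].
      rewrite app_comm_cons, cf_mat_app, <- ET.
      cbn [cf_mat]; unfold mul2; cbn [e11 e12 e21 e22]. f_equal; nia.
Qed.

(** Irrationality of sqrt f by descent: multiplying [K + d sqrt f] by [sqrt f - a], which lies
    between 0 and 1, replaces [(d, K)] by [(K - a d, f d - a K)], and [a d < K < (a + 1) d] makes
    the new [d] smaller but still positive. *)
Lemma not_square_between (f a : Z) : 0 <= a -> a ^ 2 < f < (a + 1) ^ 2 ->
  forall d K, f * d ^ 2 = K ^ 2 -> d = 0.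
Proof.
  intros Ha Hf.
  assert (P : forall d K, 0 <= d -> 0 <= K -> f * d ^ 2 = K ^ 2 -> d = 0).
  { intros d. remember (Z.to_nat d) as k eqn:Hk.
    revert d Hk; induction k as [k IH] using lt_wf_ind; intros d Hk K Hd HK E.
    destruct (Z.eq_dec d 0) as [|D0]; [assumption | exfalso].
    assert (0 < d) by lia.
    assert (L1 : a * d < K).
    { apply Z.nle_gt; intros N. assert (K ^ 2 <= (a * d) ^ 2) by nia.
      assert (a ^ 2 * d ^ 2 < f * d ^ 2) by nia. lia. }
    assert (L2 : K < (a + 1) * d).
    { apply Z.nle_gt; intros N. assert (((a + 1) * d) ^ 2 <= K ^ 2) by nia.
      assert (f * d ^ 2 < (a + 1) ^ 2 * d ^ 2) by nia. lia. }
    assert (L3 : K - a * d = 0); [| lia].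
    apply (IH (Z.to_nat (K - a * d)) ltac:(lia) _ eq_refl (f * d - a * K)).
    - lia.
    - assert (0 < f * d - a * K); [| lia].
      assert (a * K * d <= K * K) by nia.
      assert (d * (f * d - a * K) = K * (K - a * d)).
      { replace (d * (f * d - a * K)) with (f * d ^ 2 - a * d * K) by ring.
        rewrite E. ring. }
      assert (0 < K * (K - a * d)) by nia. nia.
    - apply Z.sub_move_0_r.
      transitivity ((f - a ^ 2) * (K ^ 2 - f * d ^ 2)); [ring |].
      rewrite E. ring. }
  intros d K E.
  assert (Z.abs d = 0); [| lia].
  apply (P _ (Z.abs K)); try apply Z.abs_nonneg.
  now rewrite !Z.pow_2_r, !Z.abs_square, <- !Z.pow_2_r.
Qed.


(** * Simple continued fractions: complete quotients, convergence, uniqueness *)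

Definition cf_eval (l : list Z) (y : R) : R :=
  fold_right (fun b z => (IZR b + / z)%R) y l.

Definition mob (A : mat2) (y : R) : R :=
  ((IZR (e11 A) * y + IZR (e12 A)) / (IZR (e21 A) * y + IZR (e22 A)))%R.

(** The strict bound makes [B i] the floor of [Y i], so [Y] determines the partial quotients. *)
Definition complete_quotients (B : nat -> Z) (Y : nat -> R) : Prop :=
  forall i, Y i = (IZR (B i) + / Y (S i))%R /\ (1 < Y (S i))%R.

Lemma IZR_ge1 (b : Z) : 0 < b -> (1 <= IZR b)%R.
Proof. intros H. apply IZR_le. lia. Qed.

Lemma cf_fin_ext (B B' : nat -> Z) (k : nat) :
  (forall i, B i = B' i) -> cf_fin B k = cf_fin B' k.
Proof.
  revert B B'; induction k as [|k IH]; intros B B' H; simpl; rewrite H; [reflexivity |].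
  now rewrite (IH _ (fun i => B' (S i))) by (intros; apply H).
Qed.

Lemma cf_fin_bounds (B : nat -> Z) (k : nat) :
  (forall i, 0 < B i) -> (IZR (B 0%nat) <= cf_fin B k <= IZR (B 0%nat) + 1)%R.
Proof.
  revert B; induction k as [|k IH]; intros B H; simpl; [lra |].
  pose proof (IH (fun i => B (S i)) ltac:(intros; apply H)) as I.
  pose proof (IZR_ge1 _ (H 1%nat)). simpl in I.
  pose proof (Rinv_0_lt_compat (cf_fin (fun i => B (S i)) k) ltac:(lra)).
  pose proof (Rinv_le_contravar 1 (cf_fin (fun i => B (S i)) k) ltac:(lra) ltac:(lra)).
  rewrite Rinv_1 in *. lra.
Qed.

(** Limits preserve only weak inequalities, so strictness comes from uniform bounds on the tails:
    they are at most [B 1 + 1] and, from one level deeper, at least [1 + 1 / (B 2 + 1)]. *)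
Lemma is_simple_cf_shift (x : R) (B : nat -> Z) : is_simple_cf x B ->
  is_simple_cf (/ (x - IZR (B 0%nat))) (fun i => B (S i)) /\
  (0 < x - IZR (B 0%nat) < 1)%R.
Proof.
  intros [H L].
  set (C := fun i => B (S i)).
  assert (HC : forall i, 0 < C i) by (intros; apply H).
  assert (L' : is_lim_seq (fun k => / cf_fin C k)%R (x - IZR (B 0%nat))%R).
  { apply is_lim_seq_ext with (fun k => cf_fin B (S k) - IZR (B 0%nat))%R.
    - intros k. simpl. fold C. ring.
    - apply is_lim_seq_minus'; [now apply -> is_lim_seq_incr_1 | apply is_lim_seq_const]. }
  pose proof (IZR_ge1 _ (HC 0%nat)) as H0.
  pose proof (IZR_ge1 _ (HC 1%nat)) as H1.
  assert (P : (0 < x - IZR (B 0%nat))%R).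
  { apply Rlt_le_trans with (/ (IZR (C 0%nat) + 1))%R.
    - apply Rinv_0_lt_compat; lra.
    - apply (is_lim_seq_le (fun _ => / (IZR (C 0%nat) + 1))%R (fun k => / cf_fin C k)%R
               (Finite (/ (IZR (C 0%nat) + 1))) (Finite (x - IZR (B 0%nat)))); [| apply is_lim_seq_const | exact L'].
      intros k. pose proof (cf_fin_bounds C k HC). apply Rinv_le_contravar; lra. }
  assert (Q : is_lim_seq (cf_fin C) (/ (x - IZR (B 0%nat)))%R).
  { apply is_lim_seq_ext with (fun k => / / cf_fin C k)%R.
    - intros k. apply Rinv_inv.
    - apply (is_lim_seq_inv _ (Finite (x - IZR (B 0%nat)))); [exact L' |].
      intros E. inversion E. lra. }
  split; [split; [intros; apply H | exact Q] |].
  split; [exact P |].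
  assert (K : (1 + / (IZR (C 1%nat) + 1) <= / (x - IZR (B 0%nat)))%R).
  { apply (is_lim_seq_le (fun _ => 1 + / (IZR (C 1%nat) + 1))%R (fun k => cf_fin C (S k))
               (Finite (1 + / (IZR (C 1%nat) + 1))) (Finite (/ (x - IZR (B 0%nat)))));
      [| apply is_lim_seq_const | now apply -> is_lim_seq_incr_1].
    intros k. simpl.
    pose proof (cf_fin_bounds (fun i => C (S i)) k ltac:(intros; apply HC)) as I. simpl in I.
    pose proof (Rinv_le_contravar (cf_fin (fun i => C (S i)) k) (IZR (C 1%nat) + 1) ltac:(lra) ltac:(lra)).
    lra. }
  assert (0 < / (IZR (C 1%nat) + 1))%R by (apply Rinv_0_lt_compat; lra).
  rewrite <- (Rinv_inv (x - _)). rewrite <- Rinv_1.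
  apply Rinv_lt_contravar; lra.
Qed.

Lemma is_simple_cf_unique (x y : R) (B B' : nat -> Z) :
  (forall i, B i = B' i) -> is_simple_cf x B -> is_simple_cf y B' -> x = y.
Proof.
  intros E [_ Lx] [_ Ly].
  apply is_lim_seq_unique in Lx. apply is_lim_seq_unique in Ly.
  rewrite (Lim_seq_ext _ (cf_fin B')) in Lx by (intros; now apply cf_fin_ext).
  rewrite Lx in Ly. now inversion Ly.
Qed.

(** The last clause makes each complete quotient the value of a tail, so that equal tails yield
    equal complete quotients. *)
Lemma is_simple_cf_complete_quotients (x : R) (B : nat -> Z) :
  is_simple_cf x B -> exists Y, Y 0%nat = x /\ complete_quotients B Y /\
    forall i, is_simple_cf (Y i) (fun j => B (i + j)%nat).
Proof.
  intros H.
  set (Y := fix Y i := match i with O => x | S i' => (/ (Y i' - IZR (B i')))%R end).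
  assert (T : forall i, is_simple_cf (Y i) (fun j => B (i + j)%nat)).
  { induction i as [|i IH]; [exact H |].
    destruct (is_simple_cf_shift _ _ IH) as [[P L] _].
    rewrite Nat.add_0_r in L.
    split; [intros j; rewrite Nat.add_succ_comm; apply IH |].
    apply is_lim_seq_ext with (2 := L).
    intros k. apply cf_fin_ext. intros j. f_equal. lia. }
  exists Y. split; [reflexivity | split; [| exact T]].
  intros i. destruct (is_simple_cf_shift _ _ (T i)) as [_ K].
  rewrite Nat.add_0_r in K. simpl. rewrite Rinv_inv. split; [ring |].
  rewrite <- Rinv_1 at 1. apply Rinv_lt_contravar; lra.
Qed.

Lemma Rabs_Rinv_diff (u v : R) : (0 < u)%R -> (0 < v)%R ->
  Rabs (/ u - / v) = (Rabs (u - v) / (u * v))%R.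
Proof.
  intros Hu Hv. replace (/ u - / v)%R with (- (u - v) / (u * v))%R by (field; lra).
  unfold Rdiv. rewrite Rabs_mult, Rabs_Ropp, (Rabs_pos_eq (/ (u * v))); [reflexivity |].
  apply Rlt_le, Rinv_0_lt_compat. nra.
Qed.

(* Two steps of x -> b + 1/x contract distances by 4 because consecutive complete
   quotients satisfy Y_i Y_(i+1) = b_i Y_(i+1) + 1 >= 2. *)
Lemma cf_fin_error (B : nat -> Z) (Y : nat -> R) (k : nat) :
  (forall i, 0 < B (S i)) -> complete_quotients B Y ->
  (Rabs (cf_fin B k - Y 0%nat) <= 2 * (/ 2) ^ k /\
   Rabs (cf_fin B (S k) - Y 0%nat) <= 2 * (/ 2) ^ S k)%R.
Proof.
  revert B Y; induction k as [|k IH]; intros B Y HB HY.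
  - destruct (HY 0%nat) as [E0 P1]. destruct (HY 1%nat) as [E1 P2].
    pose proof (IZR_ge1 _ (HB 0%nat)) as H1.
    assert (0 < / Y 1%nat < 1)%R.
    { split; [apply Rinv_0_lt_compat; lra |]. rewrite <- Rinv_1. apply Rinv_lt_contravar; lra. }
    assert (0 < / IZR (B 1%nat) <= 1)%R.
    { split; [apply Rinv_0_lt_compat; lra |]. rewrite <- Rinv_1. apply Rinv_le_contravar; lra. }
    rewrite E0. simpl. split; apply Rabs_le; lra.
  (* The contraction takes two steps at a time, hence the induction on two consecutive errors. *)
  - split; [now apply IH |].
    destruct (HY 0%nat) as [E0 P1]. destruct (HY 1%nat) as [E1 P2].
    pose proof (IZR_ge1 _ (HB 0%nat)) as H1.
    pose proof (IZR_ge1 _ (HB 1%nat)) as H2.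
    set (C := fun i => B (S (S i))).
    destruct (IH C (fun i => Y (S (S i)))) as [I _].
    { intros; apply HB. }
    { intros i; apply HY. }
    pose proof (cf_fin_bounds C k ltac:(intros; apply HB)) as K.
    change (C 0%nat) with (B 2%nat) in K.
    change (cf_fin B (S (S k))) with (IZR (B 0%nat) + / (IZR (B 1%nat) + / cf_fin C k))%R.
    rewrite E0, E1.
    set (u := cf_fin C k) in *. set (v := Y 2%nat) in *.
    set (b := IZR (B 1%nat)) in *.
    assert (0 < / u)%R by (apply Rinv_0_lt_compat; lra).
    assert (0 < / v)%R by (apply Rinv_0_lt_compat; lra).
    replace (IZR (B 0%nat) + / (b + / u) - (IZR (B 0%nat) + / (b + / v)))%R
      with (/ (b + / u) - / (b + / v))%R by ring.
    rewrite Rabs_Rinv_diff by lra.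
    replace (b + / u - (b + / v))%R with (/ u - / v)%R by ring.
    rewrite Rabs_Rinv_diff by lra.
    replace (Rabs (u - v) / (u * v) / ((b + / u) * (b + / v)))%R
      with (Rabs (u - v) / ((b * u + 1) * (b * v + 1)))%R by (field; repeat split; nra).
    apply Rle_trans with (Rabs (u - v) / 4)%R.
    + apply Rmult_le_compat_l; [apply Rabs_pos |]. apply Rinv_le_contravar; [lra |].
      assert (1 <= b * u)%R by nra. assert (1 <= b * v)%R by nra. nra.
    + simpl in *. lra.
Qed.

Lemma complete_quotients_is_simple_cf (B : nat -> Z) (Y : nat -> R) :
  (forall i, 0 < B (S i)) -> complete_quotients B Y -> is_simple_cf (Y 0%nat) B.
Proof.
  intros HB HY. split; [exact HB |].
  assert (G : is_lim_seq (fun k => 2 * (/ 2) ^ k)%R (Finite 0)).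
  { replace (Finite 0) with (Rbar_mult (Finite 2) (Finite 0)) by (simpl; f_equal; ring).
    apply is_lim_seq_scal_l, is_lim_seq_geom. rewrite Rabs_pos_eq; lra. }
  apply is_lim_seq_le_le with (fun k => Y 0%nat - 2 * (/ 2) ^ k)%R (fun k => Y 0%nat + 2 * (/ 2) ^ k)%R.
  - intros k. destruct (cf_fin_error B Y k HB HY) as [E _].
    apply Rabs_le_between in E. lra.
  - pose proof (is_lim_seq_minus' _ _ _ _ (is_lim_seq_const (Y 0%nat)) G) as K.
    now rewrite Rminus_0_r in K.
  - pose proof (is_lim_seq_plus' _ _ _ _ (is_lim_seq_const (Y 0%nat)) G) as K.
    now rewrite Rplus_0_r in K.
Qed.

Lemma cf_eval_pos (l : list Z) (y : R) :
  List.Forall (Z.lt 0) l -> (0 < y)%R -> (0 < cf_eval l y)%R.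
Proof.
  intros H Hy. induction H as [|b l Hb _ IH]; [exact Hy |]. simpl.
  pose proof (IZR_ge1 _ Hb). pose proof (Rinv_0_lt_compat _ IH).
  unfold cf_eval in *. lra.
Qed.

Lemma cf_eval_gt1 (b : Z) (l : list Z) (y : R) :
  List.Forall (Z.lt 0) (b :: l) -> (0 < y)%R -> (1 < cf_eval (b :: l) y)%R.
Proof.
  intros H Hy. inversion H as [|? ? Hb Hl]; subst.
  pose proof (IZR_ge1 _ Hb). pose proof (Rinv_0_lt_compat _ (cf_eval_pos _ _ Hl Hy)).
  unfold cf_eval in *; simpl. lra.
Qed.

Lemma cf_eval_mob (l : list Z) (y : R) :
  List.Forall (Z.lt 0) l -> (0 < y)%R -> cf_eval l y = mob (cf_mat l) y.
Proof.
  intros H Hy. induction H as [|b l Hb Hl IH].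
  - unfold mob; simpl. field.
  - change (cf_eval (b :: l) y) with (IZR b + / cf_eval l y)%R. rewrite IH.
    destruct (cf_mat_nonneg l Hl) as (H1 & H2 & H3 & H4 & H5 & _).
    apply IZR_le in H1, H2, H3, H4, H5. rewrite plus_IZR in H5.
    unfold mob. cbn [cf_mat mul2 e11 e12 e21 e22].
    rewrite !plus_IZR, !mult_IZR. field. split; nra.
Qed.

(** No sign is imposed on the leading entry, because [cf_mat_decompose] leaves its first quotient
    unrestricted. *)
Lemma cf_eval_cons_mob (b : Z) (l : list Z) (y : R) :
  List.Forall (Z.lt 0) l -> (0 < y)%R -> cf_eval (b :: l) y = mob (cf_mat (b :: l)) y.
Proof.
  intros Hl Hy.
  change (cf_eval (b :: l) y) with (IZR b + / cf_eval l y)%R. rewrite cf_eval_mob by assumption.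
  destruct (cf_mat_nonneg l Hl) as (H1 & H2 & H3 & H4 & H5 & _).
  apply IZR_le in H1, H2, H3, H4, H5. rewrite plus_IZR in H5.
  unfold mob. cbn [cf_mat mul2 e11 e12 e21 e22].
  rewrite !plus_IZR, !mult_IZR. field. split; nra.
Qed.

Lemma complete_quotients_eval (B : nat -> Z) (Y : nat -> R) (k i : nat) :
  complete_quotients B Y -> Y i = cf_eval (map B (seq i k)) (Y (i + k)%nat).
Proof.
  intros H. revert i; induction k as [|k IH]; intros i; simpl.
  - now rewrite Nat.add_0_r.
  - rewrite (proj1 (H i)), (IH (S i)). now rewrite Nat.add_succ_comm.
Qed.

Lemma IZR_floor_unique (b b' : Z) (y y' : R) : (1 < y)%R -> (1 < y')%R ->
  (IZR b + / y = IZR b' + / y')%R -> b = b' /\ y = y'.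
Proof.
  intros Hy Hy' E.
  assert (P : (forall z, 1 < z -> 0 < / z < 1)%R).
  { intros z Hz. split; [apply Rinv_0_lt_compat; lra |].
    rewrite <- Rinv_1. apply Rinv_lt_contravar; lra. }
  pose proof (P y Hy). pose proof (P y' Hy').
  assert (b = b').
  { assert (b < b' + 1) by (apply lt_IZR; rewrite plus_IZR; lra).
    assert (b' < b + 1) by (apply lt_IZR; rewrite plus_IZR; lra). lia. }
  split; [assumption |]. subst b'.
  rewrite <- (Rinv_inv y), <- (Rinv_inv y'). f_equal. lra.
Qed.

(** Quotients peel off one at a time as floors; [1 < y] rules out the ambiguous ending
    [b = (b - 1) + 1/1]. *)
Lemma cf_eval_unique (B : nat -> Z) (Y : nat -> R) (l : list Z) (b : Z) (i : nat) (y : R) :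
  complete_quotients B Y -> List.Forall (Z.lt 0) l -> (1 < y)%R ->
  Y i = cf_eval (b :: l) y ->
  b :: l = map B (seq i (S (length l))) /\ y = Y (i + S (length l))%nat.
Proof.
  intros HY Hl Hy. revert b i; induction Hl as [|b' l Hb' Hl IH]; intros b i E.
  - destruct (HY i) as [E' P]. rewrite E' in E. simpl in E.
    apply IZR_floor_unique in E; [| exact P | exact Hy]. destruct E as [<- <-].
    simpl. now rewrite Nat.add_1_r.
  - destruct (HY i) as [E' P]. rewrite E' in E.
    change (cf_eval (b :: b' :: l) y) with (IZR b + / cf_eval (b' :: l) y)%R in E.
    apply IZR_floor_unique in E; [| exact P | apply cf_eval_gt1; [now constructor | lra]].
    destruct E as [<- E2]. destruct (IH _ _ E2) as [El ->].
    cbn [map seq length] in *. rewrite <- El. split; [reflexivity |]. f_equal. lia.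
Qed.

(** * Periodic continued fractions *)

Lemma periodic_quotients_block (b0 : Z) (l : list Z) :
  map (periodic_quotients b0 l) (seq 1 (length l)) = l.
Proof.
  apply nth_ext with 0 0.
  - now rewrite length_map, length_seq.
  - intros i Hi. rewrite length_map, length_seq in Hi.
    rewrite nth_indep with (d' := periodic_quotients b0 l 0) by now rewrite length_map, length_seq.
    rewrite map_nth, seq_nth by assumption. simpl.
    now rewrite Nat.mod_small.
Qed.

Lemma periodic_quotients_period (b0 : Z) (l : list Z) (i : nat) :
  periodic_quotients b0 l (S (i + length l)) = periodic_quotients b0 l (S i).
Proof.
  destruct l as [|b l]; [simpl; now rewrite Nat.add_0_r |].
  cbn [periodic_quotients]. f_equal.
  rewrite <- (Nat.mul_1_l (length (b :: l))) at 1. now rewrite Nat.Div0.mod_add.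
Qed.

(** The complete quotients are explicit: after the first one they are the suffixes of the block,
    evaluated at the fixed point [y]. *)
Lemma is_periodic_cf_of_fixpoint (x y : R) (b0 : Z) (l : list Z) :
  l <> [] -> List.Forall (Z.lt 0) l -> (0 < y)%R -> y = cf_eval l y ->
  x = (IZR b0 + / y)%R -> is_periodic_cf x b0 l.
Proof.
  intros Hnil Hl Hy Ey Ex. split; [exact Hnil |].
  assert (HL : (0 < length l)%nat) by (destruct l; [easy | simpl; lia]).
  assert (HM : forall i, (i mod length l < length l)%nat) by (intros; apply Nat.mod_upper_bound; lia).
  assert (Sk : forall j, (j < length l)%nat -> skipn j l = nth j l 0 :: skipn (S j) l).
  { clear. induction l as [|b l IH]; intros j Hj; [simpl in Hj; lia |].
    destruct j as [|j]; [reflexivity |]. simpl in *. apply IH. lia. }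
  set (Y := fun i => match i with O => x | S j => cf_eval (skipn (j mod length l) l) y end).
  change x with (Y 0%nat). apply complete_quotients_is_simple_cf.
  - intros i. simpl. eapply List.Forall_forall; [exact Hl |]. now apply nth_In.
  - assert (Pos : forall i, List.Forall (Z.lt 0) (skipn i l)).
    { intros i. rewrite <- (firstn_skipn i l) in Hl. now apply Forall_app in Hl. }
    intros i. split.
    + destruct i as [|i].
      * simpl. rewrite Nat.Div0.mod_0_l. simpl. now rewrite <- Ey.
      * unfold Y at 1. rewrite (Sk _ (HM i)). simpl.
        replace (cf_eval (skipn (S i mod length l) l) y)
          with (cf_eval (skipn (S (i mod length l)) l) y); [reflexivity |].
        assert (E : (S i mod length l = S (i mod length l) mod length l)%nat).
        { rewrite <- (Nat.add_1_r i), <- (Nat.add_1_r (i mod _)).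
          now rewrite Nat.Div0.add_mod_idemp_l. }
        rewrite E. pose proof (HM i).
        (* At the end of the block the suffix is empty and has value [y], while the wrapped index
           calls for the whole block; the fixed-point equation matches them. *)
        destruct (Nat.eq_dec (S (i mod length l)) (length l)) as [E' | N].
        -- rewrite E', Nat.Div0.mod_same, skipn_all. exact Ey.
        -- now rewrite (Nat.mod_small (S (i mod length l))) by lia.
    + unfold Y. rewrite (Sk _ (HM i)). apply cf_eval_gt1; [| exact Hy].
      rewrite <- (Sk _ (HM i)). apply Pos.
Qed.


(** * Square roots and symmetric continuant matrices *)

Lemma sq_inj (x y : Z) : 0 <= x -> 0 <= y -> x ^ 2 = y ^ 2 -> x = y.
Proof. intros Hx Hy E. nia. Qed.

(** Put [y = 1 / (sqrt D - A)]. Since [2 A + 1/y = A + sqrt D], the block fixes [y] as soon as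
    [cf_mat l] sends [A + sqrt D] to [y]. Clearing denominators, the sqrt D terms cancel by symmetry
    and the rest is the last hypothesis. *)
Lemma sqrt_cf_of_symmetric_block (D A p q s : Z) (l : list Z) :
  0 < A -> List.Forall (Z.lt 0) l -> cf_mat l = Mat2 p q q s ->
  2 * A * q + s = p * (D - A ^ 2) ->
  is_periodic_cf (sqrt (IZR D)) A (l ++ [2 * A]).
Proof.
  intros HA Hl M E.
  destruct (cf_mat_nonneg l Hl) as (H1 & H2 & _ & H4 & H5 & _).
  rewrite M in *; cbn [e11 e12 e21 e22] in *.
  assert (HD : A ^ 2 < D) by nia.
  assert (HS : (sqrt (IZR D) * sqrt (IZR D) = IZR D)%R) by (apply sqrt_sqrt, IZR_le; nia).
  assert (HL : (IZR A < sqrt (IZR D))%R).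
  { rewrite <- (sqrt_Rsqr (IZR A)) by (apply IZR_le; lia).
    apply sqrt_lt_1; [apply Rle_0_sqr | apply IZR_le; nia |].
    unfold Rsqr. rewrite <- mult_IZR. apply IZR_lt. nia. }
  assert (HA' : (0 < IZR A)%R) by now apply IZR_lt.
  set (S := sqrt (IZR D)) in *. set (y := (/ (S - IZR A))%R).
  assert (Hy : (0 < y)%R) by (apply Rinv_0_lt_compat; lra).
  apply is_periodic_cf_of_fixpoint with y.
  - now destruct l.
  - apply Forall_app. split; [exact Hl | repeat constructor; lia].
  - exact Hy.
  - unfold cf_eval. rewrite fold_right_app. cbn [fold_right].
    change (y = cf_eval l (IZR (2 * A) + / y)%R).
    assert (Ey : (IZR (2 * A) + / y = IZR A + S)%R).
    { unfold y. rewrite Rinv_inv, mult_IZR. ring. }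
    rewrite Ey, cf_eval_mob by (assumption || lra).
    rewrite M. unfold mob; cbn [e11 e12 e21 e22].
    apply (f_equal IZR) in E.
    rewrite plus_IZR, !mult_IZR, minus_IZR, Z.pow_2_r, mult_IZR in E.
    apply IZR_le in H2, H4, H5. rewrite plus_IZR in H5.
    assert (P : (0 < IZR q * (IZR A + S) + IZR s)%R).
    { assert (IZR 1 <= IZR A)%R by (apply IZR_le; lia). nra. }
    unfold y. apply Rmult_eq_reg_r with ((S - IZR A) * (IZR q * (IZR A + S) + IZR s))%R; [| nra].
    transitivity (IZR q * (IZR A + S) + IZR s)%R; [field; lra |].
    transitivity (IZR p * (S * S - IZR A * IZR A) + IZR q * (S - IZR A))%R; [| field; lra].
    rewrite HS, <- E. ring.
  - unfold y. rewrite Rinv_inv. ring.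
Qed.

Lemma periodic_cf_positive (x : R) (b0 : Z) (l : list Z) :
  is_periodic_cf x b0 l -> List.Forall (Z.lt 0) l.
Proof.
  intros [_ [H _]]. rewrite <- (periodic_quotients_block b0 l).
  apply Forall_map, List.Forall_forall. intros i Hi. apply in_seq in Hi.
  destruct i as [|i]; [lia | apply H].
Qed.

Lemma periodic_cf_complete_quotients (x : R) (b0 : Z) (l : list Z) :
  is_periodic_cf x b0 l ->
  exists Y, Y 0%nat = x /\ complete_quotients (periodic_quotients b0 l) Y /\
    Y 1%nat = cf_eval l (Y 1%nat).
Proof.
  intros [_ H].
  destruct (is_simple_cf_complete_quotients _ _ H) as (Y & Y0 & HY & T).
  exists Y. split; [exact Y0 | split; [exact HY |]].
  rewrite <- (periodic_quotients_block b0 l) at 1.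
  rewrite (complete_quotients_eval _ Y (length l) 1 HY) at 1.
  f_equal. eapply is_simple_cf_unique; [| apply T | apply T].
  intros i. simpl. rewrite Nat.add_comm. apply (periodic_quotients_period b0 l i).
Qed.

(** Converse of the criterion. The expansion gives [0 < sqrt f - a0 < 1], so f lies strictly between
    consecutive squares. Clearing denominators in the fixed-point equation gives a relation between
    1 and sqrt f with integer coefficients, and irrationality makes both coefficients vanish. *)
Lemma sqrt_cf_block (f a0 : Z) (l : list Z) :
  0 < f -> is_periodic_cf (sqrt (IZR f)) a0 (l ++ [2 * a0]) ->
  0 < a0 /\ a0 ^ 2 < f < (a0 + 1) ^ 2 /\ e21 (cf_mat l) = e12 (cf_mat l) /\
  2 * a0 * e12 (cf_mat l) + e22 (cf_mat l) = e11 (cf_mat l) * (f - a0 ^ 2).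
Proof.
  intros Hf H.
  pose proof (periodic_cf_positive _ _ _ H) as Pos.
  apply Forall_app in Pos. destruct Pos as [Hl Ha].
  apply List.Forall_inv in Ha.
  assert (Ha0 : 0 < a0) by lia.
  destruct (periodic_cf_complete_quotients _ _ _ H) as (Y & Y0 & HY & E).
  destruct (HY 0%nat) as [E0 P]. rewrite Y0 in E0. simpl in E0.
  set (S := sqrt (IZR f)) in *.
  assert (HS : (S * S = IZR f)%R) by (apply sqrt_sqrt, IZR_le; lia).
  assert (Ha' : (1 <= IZR a0)%R) by now apply IZR_ge1.
  assert (I : (0 < / Y 1%nat < 1)%R).
  { split; [apply Rinv_0_lt_compat; lra |].
    rewrite <- Rinv_1. apply Rinv_lt_contravar; lra. }
  assert (B : a0 ^ 2 < f < (a0 + 1) ^ 2).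
  { split; apply lt_IZR; rewrite <- HS, Z.pow_2_r, mult_IZR, ?plus_IZR; nra. }
  split; [exact Ha0 | split; [exact B |]].
  destruct (cf_mat_nonneg l Hl) as (H1 & H2 & H3 & H4 & H5 & _).
  unfold cf_eval in E. rewrite fold_right_app in E. cbn [fold_right] in E.
  fold (cf_eval l (IZR (2 * a0) + / Y 1%nat)%R) in E.
  assert (EY : (IZR (2 * a0) + / Y 1%nat = IZR a0 + S)%R) by (rewrite E0, mult_IZR; ring).
  rewrite EY in E. rewrite cf_eval_mob in E by (assumption || lra).
  set (p := e11 (cf_mat l)) in *. set (q := e12 (cf_mat l)) in *.
  set (r := e21 (cf_mat l)) in *. set (s := e22 (cf_mat l)) in *.
  assert (K : (IZR (r - q) * S = IZR (p * (f - a0 ^ 2) - (r + q) * a0 - s))%R).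
  { apply IZR_le in H3, H4, H5. rewrite plus_IZR in H5.
    assert (D : (0 < IZR r * (IZR a0 + S) + IZR s)%R) by nra.
    unfold mob in E. fold p q r s in E.
    assert (Q : (Y 1%nat * (S - IZR a0) = 1)%R).
    { replace (S - IZR a0)%R with (/ Y 1%nat)%R by lra. field. lra. }
    assert (G : (IZR r * (IZR a0 + S) + IZR s = (IZR p * (IZR a0 + S) + IZR q) * (S - IZR a0))%R).
    { rewrite E in Q. rewrite <- (Rmult_1_l (IZR r * (IZR a0 + S) + IZR s)), <- Q.
      field. lra. }
    rewrite !minus_IZR, !mult_IZR, plus_IZR, minus_IZR, Z.pow_2_r, mult_IZR, <- HS.
    lra. }
  assert (Rq : r - q = 0).
  { apply (not_square_between f a0 ltac:(lia) B _ (p * (f - a0 ^ 2) - (r + q) * a0 - s)).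
    apply eq_IZR. rewrite !Z.pow_2_r, !mult_IZR, <- Z.pow_2_r.
    rewrite <- K, <- HS. ring. }
  split; [lia |].
  rewrite Rq, Rmult_0_l in K. apply eq_IZR in K. lia.
Qed.

(** * Pell solutions as periods of the expansion *)

(** Equal complete quotients have equal floors and therefore equal successors. *)
Lemma complete_quotients_period (B : nat -> Z) (Y : nat -> R) (i k : nat) :
  complete_quotients B Y -> Y i = Y (i + k)%nat ->
  forall j, B (i + j)%nat = B (i + k + j)%nat.
Proof.
  intros HY E.
  assert (Step : forall j j', Y j = Y j' -> B j = B j' /\ Y (S j) = Y (S j')).
  { intros j j' Ej. rewrite (proj1 (HY j)), (proj1 (HY j')) in Ej.
    apply IZR_floor_unique in Ej; [exact Ej | apply HY | apply HY]. }
  assert (E' : forall j, Y (i + j)%nat = Y (i + k + j)%nat).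
  { induction j as [|j IH]; [now rewrite !Nat.add_0_r |].
    rewrite !Nat.add_succ_r. now apply Step. }
  intros j. apply (Step _ _ (E' j)).
Qed.

(* The unimodular map z -> (c z + f h) / (h z + c) fixes sqrt f, so composed with
   z -> a0 + 1/z it expresses sqrt f through its own first complete quotient. *)
Lemma pell_solution_period (f a0 c h : Z) (l : list Z) :
  0 < f -> is_periodic_cf (sqrt (IZR f)) a0 (l ++ [2 * a0]) ->
  0 < c -> 0 < h -> c ^ 2 - f * h ^ 2 = 1 ->
  let B := periodic_quotients a0 (l ++ [2 * a0]) in
  exists k, (0 < k)%nat /\ Nat.even k = true /\
    (forall i, B (S (i + k)) = B (S i)) /\
    h = e11 (cf_mat (map B (seq 1 (k - 1)))).
Proof.
  intros Hf H Hc Hh E B.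
  destruct (sqrt_cf_block _ _ _ Hf H) as (Ha & Hfa & _).
  destruct (periodic_cf_complete_quotients _ _ _ H) as (Y & Y0 & HY & _).
  fold B in HY.
  destruct (HY 0%nat) as [E0 P]. rewrite Y0 in E0. simpl in E0.
  set (T := Mat2 (c * a0 + f * h) c (h * a0 + c) h).
  destruct (cf_mat_decompose T) as (b & l' & Hl' & ET).
  { simpl. nia. }
  { right. unfold det2; simpl. nia. }
  assert (EY : Y 0%nat = cf_eval (b :: l') (Y 1%nat)).
  { rewrite cf_eval_cons_mob, <- ET by (assumption || lra). rewrite Y0.
    set (S := sqrt (IZR f)) in *.
    assert (HS : (S * S = IZR f)%R) by (apply sqrt_sqrt, IZR_le; lia).
    unfold mob; simpl. rewrite !plus_IZR, !mult_IZR, <- HS.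
    rewrite <- (Rinv_inv (Y 1%nat)). replace (/ Y 1%nat)%R with (S - IZR a0)%R by lra.
    pose proof (Rinv_0_lt_compat (Y 1%nat) ltac:(lra)).
    assert (0 < S - IZR a0)%R by lra.
    apply IZR_lt in Hc, Hh, Ha.
    field. split; nra. }
  destruct (cf_eval_unique B Y l' b 0 (Y 1%nat) HY Hl' P EY) as [EB EP].
  set (k := length l') in *.
  simpl in EB. injection EB as _ EB.
  exists k. split; [| split; [| split]].
  - destruct k eqn:Hk; [| lia]. simpl in EB. subst l'.
    apply (f_equal e22) in ET. simpl in ET. lia.
  (* [T] has determinant -1, so its [k + 1] factors are odd in number. *)
  - pose proof (det2_cf_mat (b :: l')) as Dt. rewrite <- ET in Dt.
    assert (det2 T = -1) by (unfold det2; simpl; nia).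
    cbn [length] in Dt. fold k in Dt. rewrite Nat.even_succ in Dt. unfold Nat.odd in Dt.
    destruct (Nat.even k); [reflexivity | simpl in Dt; lia].
  - intros i. symmetry.
    replace (i + k)%nat with (k + i)%nat by lia.
    apply (complete_quotients_period B Y 1 k HY EP i).
  (* The lower right entry [h] of [T] is the continuant without the first and the last quotient,
     which leaves [k - 1] of them. *)
  - destruct k as [|j] eqn:Hk.
    { simpl in EB. subst l'. apply (f_equal e22) in ET. simpl in ET. lia. }
    rewrite seq_S, map_app in EB.
    apply (f_equal e22) in ET. rewrite EB in ET.
    cbn [cf_mat] in ET. rewrite cf_mat_app in ET.
    cbn [cf_mat mul2 e11 e12 e21 e22 map] in ET.
    replace (S j - 1)%nat with j by lia. cbn [T e22] in ET. lia.
Qed.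

Lemma periodic_cf_quotients_positive (x : R) (b0 : Z) (l : list Z) (i k : nat) :
  is_periodic_cf x b0 l ->
  List.Forall (Z.lt 0) (map (periodic_quotients b0 l) (seq (S i) k)).
Proof.
  intros [_ [H _]]. apply Forall_map, List.Forall_forall.
  intros j Hj. apply in_seq in Hj. destruct j as [|j]; [lia | apply H].
Qed.

Lemma periodic_quotients_prefix (b0 b : Z) (l : list Z) :
  map (periodic_quotients b0 (l ++ [b])) (seq 1 (S (length l))) = l ++ [b] /\
  map (periodic_quotients b0 (l ++ [b])) (seq 1 (length l)) = l.
Proof.
  pose proof (periodic_quotients_block b0 (l ++ [b])) as E.
  rewrite length_app, Nat.add_1_r in E. split; [exact E |].
  rewrite seq_S, map_app in E. now apply app_inj_tail in E.
Qed.

Lemma map_seq_shift (B : nat -> Z) (k i len : nat) :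
  (forall j, (i <= j)%nat -> B (k + j)%nat = B j) ->
  map B (seq (k + i) len) = map B (seq i len).
Proof.
  revert i; induction len as [|len IH]; intros i H; [reflexivity |]. simpl.
  rewrite H by lia. f_equal. rewrite <- Nat.add_succ_r. apply IH.
  intros j Hj. apply H. lia.
Qed.

(** Determinant -1 turns the block relation into a Pell solution [(a0 p + q, p)], so [h <= p].
    Conversely the period [k] attached to [(c, h)] is at least [length l + 1], so [l] is a prefix of
    the list whose continuant is [h], and [p <= h]. *)
Lemma fundamental_solution_odd (f a0 c h : Z) (l : list Z) :
  0 < f -> is_periodic_cf_min (sqrt (IZR f)) a0 (l ++ [2 * a0]) ->
  is_fundamental_solution f c h ->
  let p := e11 (cf_mat l) in
  let q := e12 (cf_mat l) in
  Nat.even (length l) = false -> c = a0 * p + q /\ h = p.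
Proof.
  intros Hf Hmin Hfund p q Hodd. destruct Hmin as [H M].
  destruct (sqrt_cf_block _ _ _ Hf H) as (Ha & Hfa & Sym & E). fold q p in Sym, E.
  pose proof (periodic_cf_positive _ _ _ H) as Pos. apply Forall_app in Pos.
  destruct (cf_mat_nonneg l (proj1 Pos)) as (H1 & H2 & _). fold p q in H1, H2.
  pose proof (det2_cf_mat l) as Dt. rewrite Hodd in Dt. unfold det2 in Dt. rewrite Sym in Dt.
  fold p q in Dt. set (s := e22 (cf_mat l)) in *.
  destruct Hfund as (Hc & Hh & Eq & Least).
  destruct (pell_solution_period f a0 c h l Hf H Hc Hh Eq) as (k & Hk & _ & Per & Eh).
  set (B := periodic_quotients a0 (l ++ [2 * a0])) in *.
  destruct (periodic_quotients_prefix a0 (2 * a0) l) as [Pre1 Pre2]. fold B in Pre1, Pre2.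
  specialize (M k Hk Per). rewrite length_app in M. simpl in M.
  assert (L1 : p <= h).
  { rewrite Eh. replace (k - 1)%nat with (length l + (k - 1 - length l))%nat by lia.
    rewrite seq_app, map_app, Pre2. apply cf_mat_e11_prefix.
    apply Forall_app. split; [apply Pos | now apply (periodic_cf_quotients_positive (sqrt (IZR f)))]. }
  assert (Sol : (a0 * p + q) ^ 2 - f * p ^ 2 = 1).
  { transitivity (q ^ 2 + p * (2 * a0 * q) - p * (p * (f - a0 ^ 2))); [ring |].
    rewrite <- E. lia. }
  destruct (Least (a0 * p + q) p ltac:(nia) ltac:(lia) Sol) as [L2 L3].
  assert (Ep : h = p) by lia. split; [| exact Ep].
  rewrite Ep in Eq. apply sq_inj; [lia | nia | lia].
Qed.

(** Determinant 1 gives [X^2 - f p^2 = -1], and squaring [X + p sqrt f] yields the claimed solution.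
    For the lower bound on [h], [k] is even while [n + 1] is odd, and a difference of periods is a
    period, so [k >= 2 (n + 1)]; the prefix [l, 2 a0, l] then has continuant [2 X p]. *)
Lemma fundamental_solution_even (f a0 c h : Z) (l : list Z) :
  0 < f -> is_periodic_cf_min (sqrt (IZR f)) a0 (l ++ [2 * a0]) ->
  is_fundamental_solution f c h ->
  let p := e11 (cf_mat l) in
  let q := e12 (cf_mat l) in
  Nat.even (length l) = true ->
  c = 2 * (a0 * p + q) ^ 2 + 1 /\ h = 2 * (a0 * p + q) * p.
Proof.
  intros Hf Hmin Hfund p q Heven. destruct Hmin as [H M].
  destruct (sqrt_cf_block _ _ _ Hf H) as (Ha & Hfa & Sym & E). fold q p in Sym, E.
  pose proof (periodic_cf_positive _ _ _ H) as Pos.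
  destruct (cf_mat_nonneg l) as (H1 & H2 & _).
  { now apply Forall_app in Pos. }
  fold p q in H1, H2.
  pose proof (det2_cf_mat l) as Dt. rewrite Heven in Dt. unfold det2 in Dt. rewrite Sym in Dt.
  fold p q in Dt. set (s := e22 (cf_mat l)) in *.
  destruct Hfund as (Hc & Hh & Eq & Least).
  destruct (pell_solution_period f a0 c h l Hf H Hc Hh Eq) as (k & Hk & Ek & Per & Eh).
  set (B := periodic_quotients a0 (l ++ [2 * a0])) in *.
  destruct (periodic_quotients_prefix a0 (2 * a0) l) as [Pre1 Pre2]. fold B in Pre1, Pre2.
  pose proof (M k Hk Per) as M1. rewrite length_app in M1. simpl in M1.
  set (n := length l) in *.
  assert (k <> n + 1)%nat.
  { intros ->. rewrite Nat.add_1_r, Nat.even_succ in Ek. unfold Nat.odd in Ek.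
    now rewrite Heven in Ek. }
  assert (PerB : forall i, B (S (i + (n + 1))) = B (S i)).
  { intros i. replace (n + 1)%nat with (length (l ++ [2 * a0])) by (now rewrite length_app).
    apply periodic_quotients_period. }
  assert (M2 : (n + 1 <= k - (n + 1))%nat).
  { replace (n + 1)%nat with (length (l ++ [2 * a0])) at 1 by (now rewrite length_app).
    apply M; [lia |]. intros i. fold B.
    rewrite <- PerB. replace (i + (k - (n + 1)) + (n + 1))%nat with (i + k)%nat by lia. apply Per. }
  set (X := a0 * p + q).
  assert (HX : 0 < X) by (unfold X; nia).
  assert (L1 : 2 * X * p <= h).
  { rewrite Eh. replace (k - 1)%nat with (S n + (n + (k - 1 - S n - n)))%nat by lia.
    rewrite seq_app, map_app, seq_app, map_app, Pre1.
    replace (map B (seq (1 + S n) n)) with l.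
    2: { rewrite <- Pre2 at 1. fold n. symmetry.
         replace (1 + S n)%nat with (n + 1 + 1)%nat by lia.
         apply map_seq_shift. intros [|i] Hi; [lia |].
         rewrite <- PerB. f_equal. lia. }
    rewrite app_assoc.
    replace (2 * X * p) with (e11 (cf_mat ((l ++ [2 * a0]) ++ l))).
    - apply cf_mat_e11_prefix. apply Forall_app. split; [| now apply (periodic_cf_quotients_positive (sqrt (IZR f)))].
      apply Forall_app. split; [exact Pos | now apply Forall_app in Pos].
    - rewrite !cf_mat_app. cbn [cf_mat mul2 e11 e12 e21 e22]. rewrite Sym. fold p q.
      unfold X. ring. }
  assert (Neg : X ^ 2 - f * p ^ 2 = -1).
  { transitivity (q ^ 2 + p * (2 * a0 * q) - p * (p * (f - a0 ^ 2))); [unfold X; ring |].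
    rewrite <- E. lia. }
  assert (Sol : (2 * X ^ 2 + 1) ^ 2 - f * (2 * X * p) ^ 2 = 1).
  { transitivity (4 * X ^ 2 * (X ^ 2 - f * p ^ 2 + 1) + 1); [ring | rewrite Neg; ring]. }
  destruct (Least (2 * X ^ 2 + 1) (2 * X * p) ltac:(nia) ltac:(nia) Sol) as [L2 L3].
  assert (Eh' : h = 2 * X * p) by lia. split; [| exact Eh'].
  rewrite Eh' in Eq.
  pose proof (Z.pow_nonneg X 2 ltac:(lia)). apply sq_inj; lia.
Qed.


(** * Palindromic blocks and the polynomial identities *)

(** The product is [M [[b, 1], [1, 0]] M^T]. Its off-diagonal entry [u w b + u z + v w] is rewritten
    through the determinant to expose the factor [u b + 2 v] of the corner entry. *)
Lemma cf_mat_palindrome (l : list Z) (b : Z) :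
  let u := e11 (cf_mat l) in let v := e12 (cf_mat l) in
  let w := e21 (cf_mat l) in let z := e22 (cf_mat l) in
  cf_mat (l ++ b :: rev l) =
  Mat2 (u * (u * b + 2 * v)) (w * (u * b + 2 * v) + det2 (cf_mat l))
       (w * (u * b + 2 * v) + det2 (cf_mat l)) (w * (w * b + 2 * z)).
Proof.
  intros u v w z. change (b :: rev l) with ([b] ++ rev l).
  rewrite !cf_mat_app, cf_mat_rev. unfold det2, mul2, tr2.
  cbn [cf_mat mul2 e11 e12 e21 e22]. fold u v w z. f_equal; ring.
Qed.

(* k = f u^2 - X^2 is the denominator of the middle complete quotient (P + sqrt f) / k,
   and P, Q below satisfy 2 P = k b, f - P^2 = k Q > 0; hence k b <= 2 a0, so k <= 2
   apart from f = 8, 12, 15. For f = 15 the fundamental solution (4, 1) rules it out. *)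
Lemma central_quotient (f a0 b u v w z c h : Z) :
  0 < a0 -> a0 ^ 2 < f < (a0 + 1) ^ 2 ->
  1 <= u -> 0 <= v -> 0 <= w -> u * z - v * w = 1 ->
  (v = 0 /\ w = 0) \/ (v <= u /\ z <= w) ->
  1 <= b -> b = a0 \/ b = a0 - 1 -> f <> 8 -> f <> 12 ->
  is_fundamental_solution f c h ->
  h = u * (u * b + 2 * v) -> c = (a0 * u + w) * (u * b + 2 * v) + 1 ->
  u * b + 2 * v = a0 * u + w /\ f * u ^ 2 = (a0 * u + w) ^ 2 + 2.
Proof.
  intros Ha Hf Hu Hv Hw Hdet HQ Hb Hba N8 N12 (_ & _ & Eq & Least) Eh Ec.
  set (g := u * b + 2 * v) in *. set (X := a0 * u + w) in *.
  assert (Hg : 2 * v < g) by (unfold g; nia).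
  assert (HX : 0 < X) by (unfold X; nia).
  set (k := f * u ^ 2 - X ^ 2).
  (* Inserting [c = X g + 1] and [h = u g] in the Pell equation gives [g^2 k = 2 g X]. *)
  assert (Ek : g * k = 2 * X).
  { apply Z.mul_reg_l with g; [lia |]. unfold k.
    transitivity (1 - (c ^ 2 - f * h ^ 2) + 2 * g * X); [rewrite Ec, Eh; fold X g; ring | rewrite Eq; ring]. }
  assert (Hk : 0 < k) by (clear - Ek HX Hg Hv; nia).
  set (X' := a0 * v + z).
  assert (EX : u * X' - v * X = 1) by (rewrite <- Hdet; unfold X, X'; ring).
  set (P := X * X' - f * u * v).
  assert (EP : 2 * P = k * b).
  { apply Z.mul_reg_l with u; [lia |]. transitivity (k * (g - 2 * v)); [| unfold g; ring].
    transitivity (2 * X * (u * X' - v * X) - 2 * v * k); [unfold P, k; ring |].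
    rewrite EX, <- Ek. ring. }
  set (Q := X' ^ 2 - f * v ^ 2).
  assert (EQ : f - P ^ 2 = k * Q).
  { transitivity (f * (1 - (u * X' - v * X) ^ 2) + k * Q); [unfold P, k, Q; ring |].
    rewrite EX; ring. }
  (* Multiplied by [u^2], [Q] becomes [1 + k v (g - v)], where [g > 2 v]. *)
  assert (HQ' : 0 < Q).
  { assert (E : u ^ 2 * Q = 1 + k * (v * (g - v))).
    { transitivity ((u * X') ^ 2 - v ^ 2 * X ^ 2 - k * v ^ 2); [unfold Q, k; ring |].
      replace (u * X') with (1 + v * X) by (rewrite <- EX; ring).
      transitivity (1 + v * (2 * X) - k * v ^ 2); [ring | rewrite <- Ek; ring]. }
    assert (0 <= v * (g - v)) by (clear - Hv Hg; nia).
    assert (0 < u ^ 2 * Q) by (rewrite E; clear - H Hk; nia).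
    clear - H0 Hu. nia. }
  assert (Ef : f * u ^ 2 = X ^ 2 + k) by (unfold k; ring).
  assert (Dg : g = u * b + 2 * v) by reflexivity.
  assert (DX : X = a0 * u + w) by reflexivity.
  clearbody P Q k. clear EX. clearbody X' X g.
  assert (HP : P <= a0).
  { pose proof (Z.mul_pos_pos k Q Hk HQ').
    assert (P ^ 2 < (a0 + 1) ^ 2) by (clear - H EQ Hf; lia).
    clear - H0 Ha. nia. }

  assert (K : k = 1 \/ k = 2 \/ 3 <= k) by (clear - Hk; lia). destruct K as [K | [K | K]].
  (* For [k = 1], [b = 2 P] is even, so [a0 >= b >= 2] and [u (2 a0 - b) >= 2 u]. This forces
     [v - w >= u], against [v <= u] and [w > 0]. *)
  - exfalso. subst k. rewrite Dg, DX in Ek.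
    assert (2 <= b) by (clear - EP Hb; lia).
    assert (E : u * (2 * a0 - b) = 2 * (v - w)) by (clear - Ek; lia).
    assert (2 * u <= u * (2 * a0 - b)) by (clear - Hba H Hu; nia).
    destruct HQ as [[-> ->] | [HQ1 HQ2]]; [clear - E H0 Hu; lia |].
    assert (0 < w); [| clear - E H0 HQ1 H1; lia].
    destruct (Z.eq_dec w 0) as [-> |]; [clear - Hdet HQ2 Hu; nia | clear - n Hw; lia].
  - subst k. clear - Ek Ef. split; lia.
  (* Now [k b = 2 P <= 2 a0] excludes [b = a0] and leaves [(a0, b) = (2, 1)] or [(3, 2)]; [k]
     divides [f - P^2], which singles out the exceptional f. *)
  - exfalso. destruct Hba as [-> | ->]; [clear - EP HP K Ha; nia |].
    assert (a0 = 2 \/ a0 = 3) as [-> | ->].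
    { clear - EP HP K Hb. nia. }
    + assert (k = 3 \/ k = 4) as [-> | ->] by lia; [lia |].
      assert (P = 2) by lia. subst P. lia.
    + assert (k = 3) by lia. subst k. assert (P = 3) by lia. subst P.
      assert (f = 15) by lia. subst f.
      destruct (Least 4 1) as [_ L]; [lia | lia | reflexivity |].
      clear - Eh L Hg Hu Hv Dg. nia.
Qed.

(** The criterion [2 A q + s = p (D - A^2)] for the palindrome with its centre raised by [d]. The
    two sides differ by a multiple of [f u^2 - X^2 - 2]. *)
Lemma odd_quartic_identity (f a0 X u w s t : Z) :
  X = a0 * u + w -> f * u ^ 2 = X ^ 2 + 2 ->
  2 * a0 * (w * X + 1) + s = u * X * (f - a0 ^ 2) ->
  let c := X ^ 2 + 1 in let h := u * X in let d := (c - 1) * h * t in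
  let A := (c - 1) * (h ^ 3 * t ^ 2 + 2 * h * t) + a0 in
  2 * A * (w * X + 1 + d * u * w) + (s + d * w ^ 2) =
  (u * X + d * u ^ 2) * (quartic f c h t - A ^ 2).
Proof.
  intros EX Ef Es c h d A.
  assert (Ew : w = X - a0 * u) by lia.
  assert (Es' : s = u * X * (f - a0 ^ 2) - 2 * a0 * (w * X + 1)) by lia.
  apply Z.sub_move_0_r.
  transitivity (- X ^ 3 * u * t * (f * u ^ 2 - X ^ 2 - 2)); [| rewrite Ef; ring].
  subst s w. unfold A, d, h, c, quartic. ring.
Qed.

(** The same criterion for the block [l, 2 B, l]; the two sides differ by a multiple of
    [X^2 - f p^2 + 1]. *)
Lemma even_quartic_identity (f a0 p q s t : Z) :
  let X := a0 * p + q in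
  X ^ 2 - f * p ^ 2 = -1 -> 2 * a0 * q + s = p * (f - a0 ^ 2) ->
  let c := 2 * X ^ 2 + 1 in let h := 2 * X * p in
  let B := (c - 1) * h * t + a0 in
  let A := (c - 1) * (h ^ 3 * t ^ 2 + 2 * h * t) + a0 in
  2 * A * (2 * B * p * q + q * q + p * s) + 2 * q * (B * q + s) =
  2 * p * (B * p + q) * (quartic f c h t - A ^ 2).
Proof.
  intros X Ef Es c h B A.
  assert (Eq : q = X - a0 * p) by (unfold X; ring).
  assert (Es' : s = p * (f - a0 ^ 2) - 2 * a0 * q) by lia.
  apply Z.sub_move_0_r. clearbody X.
  transitivity (- 2 * (A - B) * (X ^ 2 - f * p ^ 2 + 1)); [| rewrite Ef; ring].
  subst s q. unfold A, B, h, c, quartic. ring.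
Qed.


(** * Expansions of the square root of the quartic *)

Lemma periodic_cf_prefix_positive (x : R) (b0 : Z) (l1 l2 : list Z) :
  is_periodic_cf x b0 (l1 ++ l2) -> List.Forall (Z.lt 0) l1.
Proof.
  intros H. apply periodic_cf_positive in H. now apply Forall_app in H.
Qed.

(** For [t > 0] the values excluded by [central_quotient] cannot occur; at [t = 0] the criterion is
    the relation already known for f. *)
Lemma quartic_cf_odd (f c h t a0 b : Z) (l : list Z) :
  0 < f -> is_fundamental_solution f c h -> 0 <= t ->
  is_periodic_cf_min (sqrt (IZR f)) a0 ((l ++ b :: rev l) ++ [2 * a0]) ->
  Nat.even (length l) = true -> b = a0 \/ b = a0 - 1 -> (f = 8 \/ f = 12 -> t = 0) ->
  let A := (c - 1) * (h ^ 3 * t ^ 2 + 2 * h * t) + a0 in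
  is_periodic_cf (sqrt (IZR (quartic f c h t))) A
    ((l ++ ((c - 1) * h * t + b) :: rev l) ++ [2 * A]).
Proof.
  intros Hf Hfund Ht Hmin Heven Hb Hex A.
  pose proof (proj1 Hmin) as H.
  destruct (sqrt_cf_block _ _ _ Hf H) as (Ha & Hfa & _ & E).
  pose proof (periodic_cf_prefix_positive _ _ _ _ H) as Pos.
  apply Forall_app in Pos. destruct Pos as [Pl Pb]. inversion Pb as [|? ? Hb0 Pr]; subst.
  destruct (fundamental_solution_odd f a0 c h _ Hf Hmin Hfund) as [Ec Eh].
  { rewrite length_app. cbn [length]. rewrite length_rev, Nat.add_succ_r, Nat.even_succ.
    unfold Nat.odd. rewrite Nat.even_add, Heven. reflexivity. }
  pose proof (cf_mat_palindrome l) as Pal.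
  pose proof (det2_cf_mat l) as Dt. rewrite Heven in Dt.
  destruct (cf_mat_nonneg l Pl) as (H1 & H2 & H3 & H4 & _).
  (* An empty [l] gives the identity matrix, outside the reach of [cf_mat_monotone]. *)
  assert (HQ : (e12 (cf_mat l) = 0 /\ e21 (cf_mat l) = 0) \/
               (e12 (cf_mat l) <= e11 (cf_mat l) /\ e22 (cf_mat l) <= e21 (cf_mat l))).
  { destruct l as [|b' l']; [left; split; reflexivity | right].
    destruct (cf_mat_monotone b' l' Pl). split; assumption. }
  rewrite Dt in Pal. unfold det2 in Dt.
  set (u := e11 (cf_mat l)) in *. set (v := e12 (cf_mat l)) in *.
  set (w := e21 (cf_mat l)) in *. set (z := e22 (cf_mat l)) in *.
  rewrite (Pal b) in E, Ec, Eh. cbn [e11 e12 e22] in E, Ec, Eh.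
  assert (Hc : 0 <= c - 1 /\ 0 < h).
  { destruct Hfund as (? & ? & _). lia. }
  apply sqrt_cf_of_symmetric_block
    with (u * (u * ((c - 1) * h * t + b) + 2 * v))
         (w * (u * ((c - 1) * h * t + b) + 2 * v) + 1)
         (w * (w * ((c - 1) * h * t + b) + 2 * z)).
  - unfold A. assert (0 <= h ^ 3 * t ^ 2 + 2 * h * t).
    { apply Z.add_nonneg_nonneg; repeat apply Z.mul_nonneg_nonneg; try apply Z.pow_nonneg; lia. }
    pose proof (Z.mul_nonneg_nonneg _ _ (proj1 Hc) H0). lia.
  - apply Forall_app. split; [exact Pl |]. constructor; [| exact Pr].
    assert (0 <= (c - 1) * h * t) by (repeat apply Z.mul_nonneg_nonneg; lia). lia.
  - apply Pal.
  - destruct (Z.eq_dec t 0) as [-> | T0].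
    { transitivity (2 * a0 * (w * (u * b + 2 * v) + 1) + w * (w * b + 2 * z));
        [unfold A; ring |].
      rewrite E. unfold A, quartic. ring. }
    destruct (central_quotient f a0 b u v w z c h Ha Hfa H1 H2 H3 Dt HQ
                (proj2 (Z.le_succ_l 0 b) Hb0) Hb
                (fun e => T0 (Hex (or_introl e))) (fun e => T0 (Hex (or_intror e)))
                Hfund Eh ltac:(rewrite Ec; ring)) as [Eg Ef].
    rewrite Eg in *.
    set (X := a0 * u + w) in *.
    assert (Ec' : c = X ^ 2 + 1) by (rewrite Ec; unfold X; ring).
    pose proof (odd_quartic_identity f a0 X u w (w * (w * b + 2 * z)) t eq_refl Ef) as I.
    cbv zeta in I. rewrite <- Eh, <- Ec' in I. fold A in I.
    rewrite <- Eh in E. specialize (I E).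
    set (d := (c - 1) * h * t) in *.
    replace (u * (d + b) + 2 * v) with (X + d * u) by (rewrite <- Eg; ring).
    replace (u * (X + d * u)) with (h + d * u ^ 2) by (rewrite Eh; ring).
    rewrite <- I. ring.
Qed.

(** At [t = 0] the block is two copies of the old period, which [is_periodic_cf] permits. *)
Lemma quartic_cf_even (f c h t a0 : Z) (l : list Z) :
  0 < f -> is_fundamental_solution f c h -> 0 <= t ->
  is_periodic_cf_min (sqrt (IZR f)) a0 (l ++ [2 * a0]) ->
  Nat.even (length l) = true ->
  let A := (c - 1) * (h ^ 3 * t ^ 2 + 2 * h * t) + a0 in
  is_periodic_cf (sqrt (IZR (quartic f c h t))) A
    ((l ++ [2 * ((c - 1) * h * t + a0)] ++ l) ++ [2 * A]).
Proof.
  intros Hf Hfund Ht Hmin Heven A.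
  pose proof (proj1 Hmin) as H.
  destruct (sqrt_cf_block _ _ _ Hf H) as (Ha & _ & Sym & E).
  pose proof (periodic_cf_prefix_positive _ _ _ _ H) as Pos.
  destruct (fundamental_solution_even f a0 c h l Hf Hmin Hfund Heven) as [Ec Eh].
  pose proof (det2_cf_mat l) as Dt. rewrite Heven in Dt. unfold det2 in Dt. rewrite Sym in Dt.
  assert (Hc : 0 <= c - 1 /\ 0 < h).
  { destruct Hfund as (? & ? & _). lia. }
  set (B := (c - 1) * h * t + a0).
  set (p := e11 (cf_mat l)) in *. set (q := e12 (cf_mat l)) in *.
  set (s := e22 (cf_mat l)) in *.
  apply sqrt_cf_of_symmetric_block
    with (2 * p * (B * p + q)) (2 * B * p * q + q * q + p * s) (2 * q * (B * q + s)).
  - unfold A. assert (0 <= h ^ 3 * t ^ 2 + 2 * h * t).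
    { apply Z.add_nonneg_nonneg; repeat apply Z.mul_nonneg_nonneg; try apply Z.pow_nonneg; lia. }
    pose proof (Z.mul_nonneg_nonneg _ _ (proj1 Hc) H0). lia.
  - apply Forall_app. split; [exact Pos |]. constructor; [| exact Pos].
    assert (0 <= (c - 1) * h * t) by (repeat apply Z.mul_nonneg_nonneg; lia).
    unfold B. lia.
  - rewrite !cf_mat_app. unfold mul2. cbn [cf_mat mul2 e11 e12 e21 e22]. rewrite Sym.
    fold p q s. f_equal; ring.
  - assert (Neg : (a0 * p + q) ^ 2 - f * p ^ 2 = -1).
    { transitivity (q ^ 2 + p * (2 * a0 * q) - p * (p * (f - a0 ^ 2))); [ring |].
      rewrite <- E. lia. }
    pose proof (even_quartic_identity f a0 p q s t Neg E) as I. cbv zeta in I.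
    rewrite <- Eh, <- Ec in I. exact I.
Qed.

Theorem theorem5 (f c h t : Z) (n : nat) (a : nat -> Z)
  (f_pos : 0 < f)
  (f_nonsquare : ~ (exists s : Z, f = s ^ 2))
  (sqrt_f : is_periodic_cf_min (sqrt (IZR f)) (a 0%nat)
              (block a n ++ [2 * a 0%nat]))
  (ch_fund : is_fundamental_solution f c h)
  (t_ge0 : 0 <= t) :
  (* For f = 8 and f = 12 the expansion below fails at every t > 0. *)
  (forall m : nat, odd_central a n m -> (f = 8 \/ f = 12 -> t = 0) ->
     is_periodic_cf (sqrt (IZR (quartic f c h t)))
       ((c - 1) * (h ^ 3 * t ^ 2 + 2 * h * t) + a 0%nat)
       (block a (m - 1) ++ [(c - 1) * h * t + a m] ++ rev (block a (m - 1))
        ++ [2 * (c - 1) * (h ^ 3 * t ^ 2 + 2 * h * t) + 2 * a 0%nat]))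
  /\
  (Nat.Even n ->
     is_periodic_cf (sqrt (IZR (quartic f c h t)))
       ((c - 1) * (h ^ 3 * t ^ 2 + 2 * h * t) + a 0%nat)
       (block a n ++ [2 * (c - 1) * h * t + 2 * a 0%nat] ++ block a n
        ++ [2 * (c - 1) * (h ^ 3 * t ^ 2 + 2 * h * t) + 2 * a 0%nat]))
  /\
  ((exists m : nat, odd_central a n m) \/ Nat.Even n ->
     is_fundamental_solution (quartic f c h t)
       ((c - 1) * h ^ 6 * t ^ 3 + 3 * (c - 1) * h ^ 4 * t ^ 2
        + 3 * (c - 1) * h ^ 2 * t + c)
       (h + h ^ 3 * t)).
Proof.
  split; [| split].
  - intros m (_ & Hm & Eblock & Hb) Hex.
    rewrite Eblock in sqrt_f.
    (* As [m] is odd, the truncated subtraction [m - 1] is exact and even. *)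
    assert (Heven : Nat.even (length (block a (m - 1))) = true).
    { unfold block. rewrite length_map, length_seq. apply Nat.even_spec.
      destruct Hm as [j ->]. exists j. lia. }
    pose proof (quartic_cf_odd f c h t (a 0%nat) (a m) _ f_pos ch_fund t_ge0 sqrt_f
                  Heven Hb Hex) as G.
    cbv zeta in G. rewrite <- app_assoc in G.
    replace (2 * (c - 1) * (h ^ 3 * t ^ 2 + 2 * h * t) + 2 * a 0%nat)
      with (2 * ((c - 1) * (h ^ 3 * t ^ 2 + 2 * h * t) + a 0%nat)) by ring.
    exact G.
  - intros Hn.
    assert (Heven : Nat.even (length (block a n)) = true).
    { unfold block. rewrite length_map, length_seq. now apply Nat.even_spec. }
    pose proof (quartic_cf_even f c h t (a 0%nat) _ f_pos ch_fund t_ge0 sqrt_f Heven) as G.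
    cbv zeta in G. rewrite <- !app_assoc in G.
    replace (2 * (c - 1) * (h ^ 3 * t ^ 2 + 2 * h * t) + 2 * a 0%nat)
      with (2 * ((c - 1) * (h ^ 3 * t ^ 2 + 2 * h * t) + a 0%nat)) by ring.
    replace (2 * (c - 1) * h * t + 2 * a 0%nat)
      with (2 * ((c - 1) * h * t + a 0%nat)) by ring.
    exact G.
  - intros _. now apply quartic_fundamental.
Qed.
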